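(* For all integers $m,n\ge 1$, with $\mathcal{C}\subseteq\mathbb{R}^{n^m}$ the set defined in the context, $$ext\left(B_{\mathcal{L}(^{m}\mathbb{R}^{n})}\right)=\mathcal{C}.$$
   Context: $\mathbb{R}^k$ carries the sup norm, $B_{\mathbb{R}^k}$ is its closed unit ball; $[n]=\{1,\dots,n\}$; $ext(A)$ is the set of extreme points of a convex set $A$ (so $ext(B_{\mathbb{R}^k})=\{-1,1\}^k$). For $x=(x_1,\dots,x_m)$ with $x_i\in\mathbb{R}^n$ and $\mathbf{j}=(j_1,\dots,j_m)\in[n]^m$, put $x^{\mathbf{j}}=\prod_{i=1}^m x_i^{(j_i)}\in\mathbb{R}$, where $x_i^{(j)}$ is the $j$-th coordinate of $x_i$, and $\omega(x)=(x^{\mathbf{j}})_{\mathbf{j}\in[n]^m}\in\mathbb{R}^{n^m}$ (lexicographic order on $[n]^m$). Set $V_m^n=\{\omega(x): x_i\in ext(B_{\mathbb{R}^n})\text{ for all } i\in[m]\}$ and let $G_m^n$ be the set of diagonal $n^m\times n^m$ matrices $diag(x^{\mathbf{j}})_{\mathbf{j}\in[n]^m}$ with $x_1,\dots,x_m\in ext(B_{\mathbb{R}^n})$. $\mathcal{L}(^m\mathbb{R}^n)$ is the space of $m$-linear forms $T:\mathbb{R}^n\times\cdots\times\mathbb{R}^n\to\mathbb{R}$ with norm $\|T\|=\sup_{\|x_1\|,\dots,\|x_m\|\le 1}|T(x_1,\dots,x_m)|$, and $B_{\mathcal{L}(^m\mathbb{R}^n)}$ is its closed unit ball. Each $T$ is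 written $T(y)=\sum_{\mathbf{i}\in[n]^m}a_{\mathbf{i}}y^{\mathbf{i}}=\langle a^T,\omega(y)\rangle$ with $a^T=(a_{\mathbf{i}})_{\mathbf{i}\in[n]^m}\in\mathbb{R}^{n^m}$ (a row vector), and $T$ is identified with $a^T$. Construction of $\mathcal{C}$: let $e=(1,\dots,1)\in\mathbb{R}^n$ and let $\mathcal{B}=\{\beta_1,\dots,\beta_s\}$ be the set of all bases of $\mathbb{R}^{n^m}$ contained in $V_m^n$ and containing $\omega(e,\dots,e)$. For each $i\in[s]$ let $H_{\beta_i}$ be the $n^m\times n^m$ matrix whose rows are the vectors of $\beta_i$ (in some fixed order). For $i\in[s]$ and $f\in ext(B_{\mathbb{R}^{n^m}})$ let $\mathcal{A}_{i,f}=\{a\in\mathbb{R}^{n^m}: H_{\beta_i}a^t=f^t\}$, where $t$ denotes transpose, and let $\mathcal{A}=\bigcup_{i\in[s],\,f\in ext(B_{\mathbb{R}^{n^m}})}\mathcal{A}_{i,f}$. For $g\in G_m^n$ let $\mathcal{C}_g=\{a\cdot g: a\in\mathcal{A},\ |\langle a,v\rangle|\le 1\ \text{for all } v\in V_m^n\}$, and let $\mathcal{C}=\bigcup_{g\in G_m^n}\mathcal{C}_g$. *)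

(* Defs.v *)
From HB Require Import structures.
From mathcomp Require Import all_boot all_order all_algebra.
From mathcomp Require Import finmap.
From mathcomp Require Import all_classical all_reals all_analysis.

Set Implicit Arguments.
Unset Strict Implicit.
Unset Printing Implicit Defensive.

Import Order.TTheory GRing.Theory Num.Theory.
Import numFieldNormedType.Exports.

Local Open Scope classical_set_scope.
Local Open Scope ring_scope.

Definition ext (R : realType) (E : lmodType R) (A : set E) : set E :=
  [set x | A x /\ forall (y z : E) (t : R), A y -> A z -> 0 < t < 1 ->
     x = t *: y + (1 - t) *: z -> y = x /\ z = x].

(* The library norm on row vectors is the sup norm. *)
Definition unit_ball (R : realType) (k : nat) : set 'rV[R]_k :=
  [set x | `|x| <= 1].

Definition dot (R : realType) (k : nat) (a v : 'rV[R]_k) : R :=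
  \sum_(j < k) a 0 j * v 0 j.

Section MultiIndex.
Variables m n : nat.

Fact multi_index_subproof (k : 'I_(n ^ m)) (i : 'I_m) :
  ((k %/ n ^ (m - i.+1)) %% n < n)%N.
Proof.
rewrite ltn_pmod // lt0n; apply/eqP => n0; case: k => k /=.
by rewrite n0 exp0n // (leq_trans _ (ltn_ord i)).
Qed.

(* The entry in position i (counted from 0) of the k-th element of [n]^m in
   lexicographic order, i.e. the i-th most significant of the m digits of k
   in base n. *)
Definition multi_index (k : 'I_(n ^ m)) (i : 'I_m) : 'I_n :=
  Ordinal (multi_index_subproof k i).

End MultiIndex.

Section Construction.
Variables (R : realType) (m n : nat).

Local Notation args := ('I_m -> 'rV[R]_n).
Local Notation vec := 'rV[R]_(n ^ m).

Definition omega (x : args) : vec :=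
  \row_(k < n ^ m) \prod_(i < m) x i 0 (multi_index k i).

Definition ext_args : set args :=
  [set x | forall i, ext (@unit_ball R n) (x i)].

Definition V_set : set vec := omega @` ext_args.

Definition G_set : set 'M[R]_(n ^ m) := [set diag_mx (omega x) | x in ext_args].

Definition multilinear (T : args -> R^o) : Prop :=
  forall (i : 'I_m) (x : args) (c : R) (u v : 'rV[R]_n),
    T (dfwith x i (c *: u + v)) =
      c * T (dfwith x i u) + T (dfwith x i v).

(* The supremum is finite for multilinear T, the only forms it is applied to. *)
Definition form_norm (T : args -> R^o) : R :=
  sup [set `|T x| | x in [set x : args | forall i, `|x i| <= 1]].

Definition form_ball : set (args -> R^o) :=
  [set T | multilinear T /\ form_norm T <= 1].

(* The linear bijection from R^(n^m) onto the m-linear forms through which a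
   form T is identified with its coefficient vector a^T. *)
Definition form_of (a : vec) : args -> R^o := fun y => dot a (omega y).

(* [basis_of] includes freeness, and a finite set is enumerated without
   repetition, so each beta has exactly n ^ m elements. *)
Definition bases : set {fset vec} :=
  [set beta : {fset vec} |
     [/\ forall v, v \in beta -> V_set v,
         omega (fun=> const_mx 1) \in beta
       & basis_of fullv (enum_fset beta)]].

(* A choice of the order in which the vectors of each basis are listed. *)
Definition row_ordering (ord : {fset vec} -> seq vec) : Prop :=
  forall beta, bases beta -> perm_eq (ord beta) (enum_fset beta).

Variable ord : {fset vec} -> seq vec.

Definition H_mx (beta : {fset vec}) : 'M[R]_(n ^ m) :=
  \matrix_(k < n ^ m) nth 0 (ord beta) k.

Definition calA : set vec :=
  \bigcup_(beta in bases) \bigcup_(f in ext (@unit_ball R (n ^ m)))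
    [set a | H_mx beta *m a^T = f^T].

Definition calC_ (g : 'M[R]_(n ^ m)) : set vec :=
  [set a *m g | a in [set a | calA a /\ forall v, V_set v -> `|dot a v| <= 1]].

Definition calC : set vec := \bigcup_(g in G_set) calC_ g.

End Construction.

(* Main.v *)
(* Since a multilinear form is bounded on the product of the balls by its values
   at extreme arguments, T -> a^T carries the ball of forms onto the polytope
   P = {a | |<a, v>| <= 1 for all v in V}. A point a of P is extreme iff the
   vectors v of V with |<a, v>| = 1 span: if they do not, then a can be moved
   both ways inside P along some w orthogonal to all of them, V being finite.
   The diagonal matrices diag (omega x) are involutions preserving V and P; the
   one with omega x active at a moves a to an extreme point at which
   omega (e, ..., e) = omega x * diag (omega x) is active, so that a basis of
   active vectors may be chosen to contain omega (e, ..., e). *)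
Require Import Defs.
From mathcomp Require Import all_boot all_order all_algebra.
From mathcomp Require Import finmap.
From mathcomp Require Import all_classical all_reals all_analysis.
From mathcomp Require Import ring lra.

Set Implicit Arguments.
Unset Strict Implicit.
Unset Printing Implicit Defensive.

Import Order.TTheory GRing.Theory Num.Theory.
Import numFieldNormedType.Exports.

Local Open Scope classical_set_scope.
Local Open Scope ring_scope.

(** * The unit ball of the sup norm and its extreme points *)

Lemma unit_ballP (R : realType) (k : nat) (x : 'rV[R]_k) :
  `|x| <= 1 <-> forall j, `|x 0 j| <= 1.
Proof.
rewrite /Num.norm /= mx_normrE; split=> [h j|h].
  apply: le_trans h; exact: (le_bigmax _ (fun ij => `|x ij.1 ij.2|) (ord0, j)).
by apply: bigmax_le => [|[i j] _ /=]; [exact: ler01|rewrite ord1 h].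
Qed.

(** Extremality of the endpoints of [-1, 1]. It is applied to each coordinate for the cube, and to
    each active functional for the polytope. *)
Lemma convex_norm_eq1 (R : realType) (c y z t : R) :
  `|c| = 1 -> `|y| <= 1 -> `|z| <= 1 -> 0 < t < 1 ->
  c = t * y + (1 - t) * z -> y = c /\ z = c.
Proof.
move=> hc /ler_normlP[hy1 hy2] /ler_normlP[hz1 hz2] /andP[t0 t1] e.
have [ec|ec] : c = 1 \/ c = -1.
- by case: (lerP 0 c) hc => [/ger0_norm|/ltr0_norm] -> h;
    [left|right; rewrite -h opprK].
- by split; nra.
- by split; nra.
Qed.

Lemma ext_unit_ballP (R : realType) (k : nat) (x : 'rV[R]_k) :
  ext (@unit_ball R k) x <-> forall j, `|x 0 j| = 1.
Proof.
split=> [[/unit_ballP xB xE] j|x1].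
  apply/eqP; rewrite eq_le xB leNgt; apply/negP => lt1.
  (* The slack of coordinate [j]: [x] can be moved by it in both directions without leaving the
     ball. *)
  pose d := (1 - `|x 0 j|) *: delta_mx 0 j : 'rV[R]_k.
  have dE l : d 0 l = (1 - `|x 0 j|) * (l == j)%:R by rewrite !mxE eqxx.
  have bnd (s : R) : `|s| = 1 -> unit_ball (x + s *: d).
    move=> s1; apply/unit_ballP => l; rewrite !mxE eqxx /=.
    have [->|_] := eqVneq l j; last by rewrite !mulr0 addr0 xB.
    rewrite mulr1 (le_trans (ler_normD _ _))// normrM s1 mul1r.
    by rewrite ger0_norm ?subr_ge0// addrC subrK.
  have [||||/(congr1 (fun y : 'rV_k => y 0 j)) + _] := xE _ _ 2^-1 (bnd 1 _) (bnd (-1) _).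
  - by rewrite normr1.
  - by rewrite normrN normr1.
  - by apply/andP; split; lra.
  - by apply/rowP => l; rewrite !mxE; field.
  by rewrite !mxE !eqxx /= => h; lra.
split=> [|y z t /unit_ballP yB /unit_ballP zB t01 e].
  by apply/unit_ballP => j; rewrite x1.
have h j : y 0 j = x 0 j /\ z 0 j = x 0 j.
  by apply: (@convex_norm_eq1 R _ _ _ t) => //; rewrite e !mxE.
by split; apply/rowP => j; have [] := h j.
Qed.

(** * Pairing, orthogonality and spanning lists *)

Section Dot.
Variables (R : realType) (k : nat).
Implicit Types a b v w : 'rV[R]_k.

Lemma dotDl a b v : dot (a + b) v = dot a v + dot b v.
Proof. by rewrite /dot -big_split; apply: eq_bigr => j _; rewrite mxE mulrDl. Qed.

Lemma dotZl c a v : dot (c *: a) v = c * dot a v.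
Proof. by rewrite /dot mulr_sumr; apply: eq_bigr => j _; rewrite mxE mulrA. Qed.

Lemma dotC a v : dot a v = dot v a.
Proof. by apply: eq_bigr => j _; rewrite mulrC. Qed.

Lemma dot_delta a j : dot a (delta_mx 0 j) = a 0 j.
Proof.
rewrite /dot (bigD1 j)//= big1 => [|l /negPf lj]; rewrite mxE eqxx ?lj ?mulr0//.
by rewrite eqxx mulr1 addr0.
Qed.

Lemma dot_mul_diag a u v :
  dot (a *m diag_mx u) v = dot a (v *m diag_mx u).
Proof. by apply: eq_bigr => j _; rewrite !mul_mx_diag !mxE -mulrA (mulrC (v 0 j)). Qed.

Lemma dot_mulmx m (M : 'M[R]_(m, k)) a i :
  (M *m a^T) i 0 = dot a (row i M).
Proof. by rewrite mxE; apply: eq_bigr => j _; rewrite !mxE mulrC. Qed.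

Lemma dot_span_eq0 (s : seq 'rV[R]_k) w :
  << s >>%VS = fullv -> (forall v, v \in s -> dot w v = 0) -> w = 0.
Proof.
move=> sV w0; apply/rowP => j; rewrite mxE -dot_delta.
have /(@coord_span _ _ _ (in_tuple s)) -> : delta_mx 0 j \in << s >>%VS.
  by rewrite sV memvf.
rewrite dotC; elim/big_rec: _ => [|i x _ x0].
  by rewrite /dot big1 // => l _; rewrite mxE mul0r.
by rewrite dotDl dotZl x0 dotC w0 ?mulr0 ?addr0 // mem_nth.
Qed.

Lemma orthogonal_of_not_span (s : seq 'rV[R]_k) :
  << s >>%VS <> fullv ->
  exists2 w : 'rV[R]_k, w != 0 & forall v, v \in s -> dot w v = 0.
Proof.
move=> sV; pose M := \matrix_(i < size s) nth 0 s i.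
have [/submx_full Mfull|] := boolP (row_full M).
  case: sV; apply/eqP; rewrite eqEsubv subvf; apply/subvP => v _.
  have /submxP[D ->] := Mfull _ v.
  rewrite mulmx_sum_row memv_suml // => i _.
  by rewrite memvZ // rowK memv_span // mem_nth.
(* The rows of [M] do not span, so its cokernel is nonzero; any nonzero combination of the columns
   of [cokermx M] is annihilated by [M]. *)
rewrite -cokermx_eq0 -trmx_eq0 => /rowV0Pn[w /submxP[D wE] w0].
exists w => // v vs.
have iv : (index v s < size s)%N by rewrite index_mem.
have := dot_mulmx M w (Ordinal iv); rewrite rowK nth_index // => <-.
by rewrite wE trmx_mul trmxK mulmxA mulmx_coker mul0mx mxE.
Qed.

(** Greedy extension: a vector of [s] is added only if it lies outside the span reached so far. It
    serves to complete omega (e, ..., e) to a basis of active vectors. *)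
Lemma extend_free_span (s0 s : seq 'rV[R]_k) : free s0 ->
  exists s' : seq 'rV[R]_k,
    [/\ free s', {subset s0 <= s'}, {subset s' <= s0 ++ s}
      & << s' >>%VS = << s0 ++ s >>%VS].
Proof.
elim: s s0 => [|v s IHs] s0 s0F.
  by exists s0; rewrite cats0; split.
have [vs0|vs0] := boolP (v \in << s0 >>%VS).
  have [s' [s'F s0s' s's' s'E]] := IHs s0 s0F; exists s'; split=> //.
    by move=> u /s's'; rewrite !mem_cat inE => /orP[->|->] //; rewrite !orbT.
  rewrite s'E !span_cat span_cons addvA; congr (_ + _)%VS.
  by apply/esym/addv_idPl; rewrite -memvE.
have [|s' [s'F s0s' s's' s'E]] := IHs (v :: s0); first by rewrite free_cons vs0.
exists s'; split=> //.
- by move=> u us0; apply: s0s'; rewrite inE us0 orbT.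
- move=> u /s's'; rewrite /= !(inE, mem_cat) => /orP[->|/orP[->|->]] //.
    by rewrite orbT.
  by rewrite !orbT.
- by rewrite s'E; apply: eq_span => u; rewrite /= !(inE, mem_cat) orbCA.
Qed.

End Dot.

(** Entries of absolute value 1 do not move and the others have positive slack; finiteness of [s]
    gives a common positive step. *)
Lemma small_perturbation (R : realType) (T : eqType) (s : seq T) (c d : T -> R) :
  (forall v, v \in s -> `|c v| <= 1) ->
  (forall v, v \in s -> `|c v| = 1 -> d v = 0) ->
  exists2 t, 0 < t & forall v r, v \in s -> `|r| <= t -> `|c v + r * d v| <= 1.
Proof.
elim: s => [|u s IHs] c1 cd; first by exists 1.
have [v vs|v vs|t t0 tP] := IHs.
- by apply: c1; rewrite inE vs orbT.
- by apply: cd; rewrite inE vs orbT.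
have [t' t'0 t'P] : exists2 t', 0 < t' & forall r, `|r| <= t' -> `|c u + r * d u| <= 1.
  have := c1 u (mem_head _ _); rewrite le_eqVlt => /orP[/eqP cu|cu].
    exists 1 => // r _; rewrite cd ?mem_head // mulr0 addr0 cu //.
  have d0 : 0 < 1 + `|d u| by rewrite ltr_pwDl.
  (* Slack divided by speed; the added 1 keeps the denominator positive when [d u = 0]. *)
  exists ((1 - `|c u|) / (1 + `|d u|)) => [|r]; first by rewrite divr_gt0 ?subr_gt0.
  rewrite ler_pdivlMr // => rd; rewrite (le_trans (ler_normD _ _)) // normrM.
  by have := normr_ge0 r; nra.
exists (Num.min t t') => [|v r]; first by rewrite lt_min t0.
rewrite inE le_min => /orP[/eqP->|vs] /andP[rt rt']; first exact: t'P.
exact: tP.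
Qed.

(** * Extreme points of the absolute polar of a finite set *)

Section Polytope.
Variables (R : realType) (k : nat) (V : set 'rV[R]_k) (W : seq 'rV[R]_k).
Hypothesis VW : forall v, V v <-> v \in W.

Definition polar : set 'rV[R]_k := [set a | forall v, V v -> `|dot a v| <= 1].

Lemma ext_polar_span a : ext polar a ->
  <<[seq v <- W | `|dot a v| == 1]>>%VS = fullv.
Proof.
move=> [aP aE]; apply: contrapT => /orthogonal_of_not_span[w w0 wS].
have [v vW|v vW c1|t t0 tP] := @small_perturbation R _ W (dot a) (dot w).
- exact/aP/VW.
- by apply: wS; rewrite mem_filter vW c1 eqxx.
have bnd r : `|r| <= t -> polar (a + r *: w).
  by move=> rt v /VW vW; rewrite dotDl dotZl tP.
have [||||/(canRL (addKr _)) + _] := aE _ _ 2^-1 (bnd t _) (bnd (- t) _).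
- by rewrite gtr0_norm.
- by rewrite normrN gtr0_norm.
- by apply/andP; split; lra.
- by apply/rowP => l; rewrite !mxE; field.
by rewrite addNr => /eqP; rewrite scaler_eq0 (negPf w0) gt_eqF.
Qed.

(** If [a] lies strictly between [y] and [z] in the polytope, the case of [-1, 1] makes both agree
    with [a] on every vector of [s], hence everywhere. *)
Lemma span_ext_polar a (s : seq 'rV[R]_k) : polar a ->
  (forall v, v \in s -> V v /\ `|dot a v| = 1) -> << s >>%VS = fullv ->
  ext polar a.
Proof.
move=> aP sP sV; split=> // y z t yP zP t01 e.
have h v : v \in s -> dot y v = dot a v /\ dot z v = dot a v.
  move=> /sP[vV v1]; apply: (@convex_norm_eq1 R _ _ _ t) => //; [exact: yP|exact: zP|].
  by rewrite e dotDl !dotZl.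
split; apply/eqP; rewrite -subr_eq0; apply/eqP/(dot_span_eq0 (s := s)) => // v vs;
  by rewrite dotDl -scaleN1r dotZl; have [h1 h2] := h v vs; rewrite ?h1 ?h2 mulN1r subrr.
Qed.

End Polytope.

(** * Lexicographic enumeration of multi-indices *)

Section MultiIndex.
Variables m n : nat.

Lemma multi_index_inj (k l : 'I_(n ^ m)) : multi_index k =1 multi_index l -> k = l.
Proof.
move=> kl; apply: val_inj => /=.
(* The quotient by [n ^ (m - j)] is the number formed by the [j] leading digits: it is 0 for
   [j = 0], and each further digit determines the next one. *)
suff /(_ m (leqnn m)) : forall j, (j <= m)%N -> (k %/ n ^ (m - j) = l %/ n ^ (m - j))%N.
  by rewrite subnn !divn1.
elim=> [_|j IHj jm]; first by rewrite subn0 !divn_small.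
rewrite (divn_eq (k %/ _) n) (divn_eq (l %/ _) n) -!divnMA -expnSr -subSn // subSS.
rewrite (IHj (ltnW jm)); congr (_ + _)%N.
exact: (congr1 val (kl (Ordinal jm))).
Qed.

Lemma multi_index_surj (f : 'I_m -> 'I_n) : exists k, multi_index k =1 f.
Proof.
pose F (k : 'I_(n ^ m)) := [ffun i => multi_index k i].
have Finj : injective F.
  by move=> k l /ffunP kl; apply: multi_index_inj => i; have := kl i; rewrite !ffunE.
have [|G _ FG] := inj_card_bij Finj; first by rewrite card_ffun !card_ord.
by exists (G (finfun f)) => i; have /ffunP/(_ i) := FG (finfun f); rewrite !ffunE.
Qed.

End MultiIndex.

(** * Multilinear forms and their coefficient vectors *)

Section Forms.
Variables (R : realType) (m n : nat).
Local Notation args := ('I_m -> 'rV[R]_n).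
Local Notation vec := 'rV[R]_(n ^ m).
Implicit Types (x y : args) (a : vec).

Lemma dfwith_id x i : dfwith x i (x i) = x.
Proof. by apply/funext => j; case: dfwithP. Qed.

(* The coordinates are moved from A to B one at a time. *)
Lemma args_ind (P : args -> Prop) (A B : set 'rV[R]_n) :
  (forall i x, (forall u, A u -> P (dfwith x i u)) ->
     forall u, B u -> P (dfwith x i u)) ->
  (forall x, (forall i, A (x i)) -> P x) ->
  forall x, (forall i, B (x i)) -> P x.
Proof.
move=> step base x xB.
suff main k : forall y, (forall i : 'I_m, (i < k)%N -> B (y i)) ->
    (forall i : 'I_m, (k <= i)%N -> A (y i)) -> P y.
  by apply: (main m) => i; [move=> _; exact: xB|rewrite leqNgt ltn_ord].
elim: k => [|k IHk] y yB yA; first by apply: base => i; exact: yA.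
have [km|mk] := ltnP k m; last first.
  apply: IHk => i ki; first by apply: yB; rewrite ltnS ltnW.
  by have := leq_trans mk ki; rewrite leqNgt ltn_ord.
pose i0 := Ordinal km; rewrite -(dfwith_id y i0).
apply: (step i0 y) => [u uA|]; last exact: (yB i0 (ltnSn k)).
apply: IHk => i ik; have [ei|ne] := eqVneq i0 i.
- by move: ik; rewrite -ei ltnn.
- by rewrite dfwithout //; apply/yB/ltnW.
- by rewrite -ei dfwithin.
- by rewrite dfwithout //; apply: yA; rewrite ltn_neqAle ik andbT.
Qed.

Lemma multilinear_sum (T : args -> R^o) : multilinear T ->
  forall i x (u : 'rV[R]_n),
    T (dfwith x i u) = \sum_j u 0 j * T (dfwith x i (delta_mx 0 j)).
Proof.
move=> TL i x u; rewrite {1}(row_sum_delta u).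
elim/big_rec2: _ => [|j y v _ <-]; last exact: TL.
(* The empty sum: additivity at zero reads T(0) = T(0) + T(0). *)
have := TL i x 1 0 0; rewrite scaler0 addr0 mul1r => /eqP.
by rewrite addrC -subr_eq subrr => /eqP.
Qed.

Lemma ext_argsP x : ext_args x <-> forall i j, `|x i 0 j| = 1.
Proof.
split=> h i; first by move=> j; have /ext_unit_ballP := h i.
by apply/ext_unit_ballP.
Qed.

Lemma ext_args_ball x : ext_args x -> forall i, `|x i| <= 1.
Proof. by move=> /ext_argsP h i; apply/unit_ballP => j; rewrite h. Qed.

Lemma multilinear_ball (T : args -> R^o) : multilinear T ->
  (forall x, ext_args x -> `|T x| <= 1) ->
  forall x, (forall i, `|x i| <= 1) -> `|T x| <= 1.
Proof.
move=> TL T1.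
apply: (@args_ind (fun x => `|T x| <= 1) (ext (@unit_ball R n)) (@unit_ball R n)) => //.
move=> i x xA u /unit_ballP uB.
(* With the other arguments fixed, T is linear in argument [i]. The signs of its coefficients form
   an extreme point at which it equals their l1 norm, which bounds it on the whole ball. *)
pose s : 'rV[R]_n := \row_j (if 0 <= T (dfwith x i (delta_mx 0 j)) then 1 else -1).
have sT : T (dfwith x i s) = \sum_j `|T (dfwith x i (delta_mx 0 j))|.
  rewrite multilinear_sum //; apply: eq_bigr => j _; rewrite mxE.
  by case: ger0P => _; rewrite (mul1r, mulN1r).
have sB : `|T (dfwith x i s)| <= 1.
  by apply/xA/ext_unit_ballP => j; rewrite mxE; case: ifP; rewrite ?normrN normr1.
apply: le_trans sB; rewrite sT [leRHS]ger0_norm ?sumr_ge0 // multilinear_sum //.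
apply: le_trans (ler_norm_sum _ _ _) _; apply: ler_sum => j _.
by rewrite normrM ler_piMl.
Qed.

Lemma form_of_multilinear a : multilinear (form_of a).
Proof.
move=> i x c u v; rewrite /form_of /dot mulr_sumr -big_split; apply: eq_bigr => k _ /=.
rewrite !mxE !(bigD1 (P := xpredT) i) //= !dfwithin !mxE.
have E w : \prod_(j < m | j != i) dfwith x i w j 0 (multi_index k j) =
    \prod_(j < m | j != i) x j 0 (multi_index k j).
  by apply: eq_bigr => j ji; rewrite dfwithout // eq_sym.
by rewrite !E; ring.
Qed.

Lemma form_of_ballP a : form_norm (form_of a) <= 1 <-> polar (@V_set R m n) a.
Proof.
(* A supremum bounds its set only if that set is bounded above; the l1 norm of [a] is a crude
   bound. *)
have bnd : has_ubound [set `|form_of a x| | x in [set x : args | forall i, `|x i| <= 1]].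
  exists (\sum_k `|a 0 k|) => _ [x xB <-].
  apply: le_trans (ler_norm_sum _ _ _) _; apply: ler_sum => k _.
  rewrite normrM ler_piMr // mxE normr_prod prodr_ile1 // => i _.
  by rewrite normr_ge0; have /unit_ballP -> := xB i.
split=> [h _ [x xV <-]|h].
  by apply: le_trans h; apply: ub_le_sup => //; exists x => //; exact: ext_args_ball.
apply: ge_sup => [|_ [x xB <-]].
  by exists `|form_of a (fun=> 0)|, (fun=> 0) => // i; rewrite normr0.
apply: multilinear_ball xB; first exact: form_of_multilinear.
by move=> y yE; apply: h; exists y.
Qed.

(** Hence evaluating a form at standard basis vectors reads off its coefficients, which yields both
    injectivity and surjectivity of [form_of]. *)
Lemma omega_delta (k : 'I_(n ^ m)) :
  omega (fun i => delta_mx 0 (multi_index k i) : 'rV[R]_n) = delta_mx 0 k.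
Proof.
apply/rowP => l; rewrite !mxE eqxx /=.
have [->|lk] := eqVneq l k; first by rewrite big1 // => i _; rewrite mxE !eqxx.
have /existsP[i il] : [exists i, multi_index l i != multi_index k i].
  apply: contraNT lk => /existsPn h; apply/eqP/multi_index_inj => i.
  by apply/eqP; have := h i; rewrite negbK.
by rewrite (bigD1 i) //= mxE (negPf il) andbF mul0r.
Qed.

Lemma form_of_inj : injective (@form_of R m n).
Proof.
move=> a b ab; apply/rowP => k.
by rewrite -!dot_delta -omega_delta; exact: (congr1 (fun T => T _) ab).
Qed.

Lemma form_of_surj (T : args -> R^o) : multilinear T -> exists a, T = form_of a.
Proof.
move=> TL; pose a : vec := \row_k T (fun i => delta_mx 0 (multi_index k i)).
exists a; apply/funext => x.
(* Both sides are multilinear, so agreement on standard basis vectors spreads to all arguments, one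
   coordinate at a time. *)
apply: (@args_ind (fun x => T x = form_of a x) (range (delta_mx 0)) setT) => //.
- move=> i y yA u _; rewrite (multilinear_sum TL).
  rewrite (multilinear_sum (form_of_multilinear a)).
  by apply: eq_bigr => j _; rewrite yA //; exists j.
- move=> y yA; have /choice[f fE] : forall i, exists j, delta_mx 0 j = y i.
    by move=> i; have [j _ <-] := yA i; exists j.
  have [k kf] := multi_index_surj f.
  have -> : y = (fun i => delta_mx 0 (multi_index k i)).
    by apply/funext => i; rewrite kf fE.
  by rewrite /form_of omega_delta dot_delta mxE.
Qed.

Lemma form_of_comb a b (c d : R) :
  form_of (c *: a + d *: b) = c *: (form_of a : _ -> R^o) + d *: (form_of b : _ -> R^o).
Proof. by apply/funext => x; rewrite /form_of dotDl !dotZl. Qed.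

Lemma form_ballP a : form_ball (form_of a) <-> polar (@V_set R m n) a.
Proof.
split=> [[_] /form_of_ballP //|/form_of_ballP h].
by split=> //; exact: form_of_multilinear.
Qed.

Lemma ext_form_ball :
  ext (@form_ball R m n) = [set form_of a | a in ext (polar (@V_set R m n))].
Proof.
apply/seteqP; split=> [T [TB TE]|_ [a [aP aE] <-]].
  have [a aT] := form_of_surj TB.1; subst T; exists a => //.
  split=> [|y z t yP zP t01 e]; first exact/form_ballP.
  have [|||/form_of_inj-> /form_of_inj->//] := TE (form_of y) (form_of z) t _ _ t01.
  - exact/form_ballP.
  - exact/form_ballP.
  - by rewrite e form_of_comb.
split=> [|Y Z t YB ZB t01 e]; first exact/form_ballP.
have [y yY] := form_of_surj YB.1; have [z zZ] := form_of_surj ZB.1; subst Y Z.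
have [|||-> ->//] := aE y z t _ _ t01; try exact/form_ballP.
by apply: form_of_inj; rewrite form_of_comb.
Qed.

(** * Finiteness of V and its diagonal symmetries *)

Lemma V_set_seq : exists W : seq vec, forall v, V_set v <-> v \in W.
Proof.
(* An extreme argument tuple is a pattern of m * n signs, and there are finitely many patterns. *)
pose sgn_args (s : {ffun 'I_m * 'I_n -> bool}) : args :=
  fun i => \row_j (-1) ^+ s (i, j).
exists [seq omega (sgn_args s) | s : {ffun 'I_m * 'I_n -> bool}] => v.
split=> [[x /ext_argsP x1 <-]|/mapP[s _ ->]]; last first.
  by exists (sgn_args s) => //; apply/ext_argsP => i j; rewrite mxE normr_sign.
apply/mapP; exists [ffun p => x p.1 0 p.2 < 0]; rewrite ?mem_enum //.
congr omega; apply/funext => i; apply/rowP => j; rewrite mxE ffunE /=.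
by have := x1 i j; case: ltrgt0P => [_ ->|_ <-|->] //;
  rewrite ?opprK // normr0 => /eqP; rewrite eq_sym oner_eq0.
Qed.

Lemma omega_mul x y :
  omega x *m diag_mx (omega y) = omega (fun i => \row_j (x i 0 j * y i 0 j)).
Proof.
rewrite mul_mx_diag; apply/rowP => k; rewrite !mxE -big_split.
by apply: eq_bigr => i _; rewrite mxE.
Qed.

Lemma omega_ext_sqr x : ext_args x -> omega x *m diag_mx (omega x) = omega (fun=> const_mx 1).
Proof.
move=> /ext_argsP x1; rewrite omega_mul; congr omega; apply/funext => i.
by apply/rowP => j; rewrite !mxE -expr2 -real_normK ?num_real // x1 expr1n.
Qed.

Lemma mulmx_omega_ext_K x : ext_args x ->
  involutive (fun a => a *m diag_mx (omega x)).
Proof.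
move=> x1 a; have /rowP e := omega_ext_sqr x1.
apply/rowP => k; have := e k.
rewrite !mul_mx_diag !mxE [in RHS]big1 => [h|i _]; last by rewrite mxE.
by rewrite -mulrA h mulr1.
Qed.

Lemma V_set_mul x v : ext_args x -> V_set v -> V_set (v *m diag_mx (omega x)).
Proof.
move=> /ext_argsP x1 [y /ext_argsP y1 <-]; rewrite omega_mul.
exists (fun i => \row_j (y i 0 j * x i 0 j)) => //.
by apply/ext_argsP => i j; rewrite mxE normrM x1 y1 mulr1.
Qed.

Lemma polar_mul x a : ext_args x -> polar (@V_set R m n) a ->
  polar (@V_set R m n) (a *m diag_mx (omega x)).
Proof. by move=> x1 aP v vV; rewrite dot_mul_diag; exact/aP/V_set_mul. Qed.

Lemma ext_polar_mul x a : ext_args x -> ext (polar (@V_set R m n)) a ->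
  ext (polar (@V_set R m n)) (a *m diag_mx (omega x)).
Proof.
move=> x1 [aP aE]; split=> [|y z t yP zP t01 e]; first exact: polar_mul.
have [] := aE _ _ t (polar_mul x1 yP) (polar_mul x1 zP) t01.
  by rewrite !scalemxAl -mulmxDl -e mulmx_omega_ext_K.
by move=> ya za; split; [rewrite -ya|rewrite -za]; rewrite mulmx_omega_ext_K.
Qed.

End Forms.

(** * The set C consists of the extreme points of the polytope *)

Section Construction.
Variables (R : realType) (m n : nat).
Hypothesis n_gt0 : (0 < n)%N.
Variable ord : {fset 'rV[R]_(n ^ m)} -> seq 'rV[R]_(n ^ m).
Hypothesis ordP : row_ordering ord.
Local Notation one := (omega (fun=> const_mx 1) : 'rV[R]_(n ^ m)).

Lemma V_set_one : V_set one.
Proof. by exists (fun=> const_mx 1) => //; apply/ext_argsP => i j; rewrite mxE normr1. Qed.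

Lemma one_neq0 : one != 0.
Proof.
have k : 'I_(n ^ m) by apply: (Ordinal (n := n ^ m) (m := 0)); rewrite expn_gt0 n_gt0.
apply/negP => /eqP/rowP/(_ k); rewrite !mxE big1 => [/eqP|i _]; last by rewrite mxE.
by rewrite oner_eq0.
Qed.

(** This ensures that the rows of [H_mx] exhaust the basis and never take the default value 0 of
    [nth]. *)
Lemma size_ord beta : bases beta -> size (ord beta) = (n ^ m)%N.
Proof.
move=> hb; have [_ _ bB] := hb; rewrite (perm_size (ordP hb)).
have := size_basis (X := in_tuple (enum_fset beta)) bB.
by rewrite dimvf dim_matrix mul1r.
Qed.

(** The entries of [f] are 1 or -1, so the linear system says that every vector of the basis [beta]
    is active at [a]. *)
Lemma calA_ext_polar a : calA ord a -> polar (@V_set R m n) a ->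
  ext (polar (@V_set R m n)) a.
Proof.
move=> [beta hb [f /ext_unit_ballP f1 Ha]] aP; have [bV _ bB] := hb.
apply: (span_ext_polar (s := ord beta)) => // [v|]; last first.
  by rewrite -(span_basis bB); apply/eq_span/perm_mem/ordP.
move=> vo; split; first by apply: bV; rewrite -(perm_mem (ordP hb)).
have iv : (index v (ord beta) < n ^ m)%N.
  by apply: leq_trans (eq_leq (size_ord hb)); rewrite index_mem.
have := f1 (Ordinal iv).
have -> : f 0 (Ordinal iv) = f^T (Ordinal iv) 0 by rewrite mxE.
by rewrite -Ha dot_mulmx rowK nth_index.
Qed.

Lemma ext_polar_calA a : ext (polar (@V_set R m n)) a -> `|dot a one| = 1 ->
  calA ord a.
Proof.
move=> aE a1; have [W VW] := V_set_seq R m n.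
have := ext_polar_span VW aE; set S := [seq v <- W | _] => SV.
have oneS : one \in S by rewrite mem_filter a1 eqxx; apply/VW/V_set_one.
have [|s [sF os sS sV]] := @extend_free_span R _ [:: one] S.
  by rewrite seq1_free one_neq0.
have sS' v : v \in s -> v \in S by move=> /sS; rewrite mem_cat inE => /orP[/eqP->|].
pose beta : {fset 'rV[R]_(n ^ m)} := [fset v in s]%fset.
have betaE v : (v \in beta) = (v \in s) by rewrite inE.
have sP : perm_eq (enum_fset beta) s.
  by apply: uniq_perm; [exact: fset_uniq|exact: free_uniq|exact: betaE].
have hb : bases beta.
  split=> [v||].
  - by rewrite betaE => /sS'; rewrite mem_filter => /andP[_ /VW].
  - by rewrite betaE os ?mem_head.
  - rewrite (perm_basis _ sP) basisEdim; apply/andP; split.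
      rewrite sV span_cat SV addvf; exact: subvv.
    by rewrite -(eqP sF) dimvS ?subvf.
(* The right-hand side [f] is read off from [a]; its entries are 1 or -1 because the rows are
   active. *)
exists beta => //; exists (H_mx ord beta *m a^T)^T; last by rewrite trmxK.
apply/ext_unit_ballP => k; rewrite mxE dot_mulmx rowK.
have : nth 0 (ord beta) k \in S.
  by apply: sS'; rewrite -betaE -(perm_mem (ordP hb)) mem_nth ?size_ord.
by rewrite mem_filter => /andP[/eqP].
Qed.

Lemma calC_ext_polar : calC ord = ext (polar (@V_set R m n)).
Proof.
apply/seteqP; split=> [_ [_ [x x1 <-] [a [aA aP] <-]]|a aE].
  by apply: ext_polar_mul => //; exact: calA_ext_polar.
have [W VW] := V_set_seq R m n.
have := ext_polar_span VW aE.
(* Some vector is active: an empty list would span only 0, whereas omega (e, ..., e) is nonzero. *)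
case E: [seq v <- W | _] => [|v S].
  move=> /(dot_span_eq0 (w := one)) one0; have /eqP : one = 0 by exact: one0.
  by rewrite (negPf one_neq0).
move=> _; have : v \in [seq v <- W | `|dot a v| == 1] by rewrite E mem_head.
rewrite mem_filter => /andP[/eqP av /VW[x x1 xv]].
exists (diag_mx (omega x)); first by exists x.
have bE := ext_polar_mul x1 aE.
exists (a *m diag_mx (omega x)); last exact: mulmx_omega_ext_K.
split; last exact: bE.1.
apply: ext_polar_calA => //.
(* Moving the diagonal matrix across the pairing turns omega (e, ..., e) back into [omega x], which
   is the active vector [v]. *)
by rewrite -(omega_ext_sqr x1) dot_mul_diag mulmx_omega_ext_K // xv.
Qed.

End Construction.

Theorem theorem15 (R : realType) (m n : nat) (hm : (1 <= m)%N) (hn : (1 <= n)%N)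
    (ord : {fset 'rV[R]_(n ^ m)} -> seq 'rV[R]_(n ^ m))
    (hord : row_ordering ord) :
  ext (@form_ball R m n) = [set form_of a | a in calC ord].
Proof. by rewrite (calC_ext_polar hn hord) ext_form_ball. Qed.
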